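(* Let $p\geq 3$ be a prime and $\mathbf{F}$ a field of characteristic $p$. Let $\{X,Y,Z\}$ be a basis of $V_3^*$ with $\Delta(Z)=Y$, $\Delta(Y)=X$, $\Delta(X)=0$, and let $N(Z)=\prod_{i=1}^p\sigma^i(Z)\in \mathbf{F}[X,Y,Z]$. Write $N(Z)=A_0+A_1X+\cdots+A_pX^p$ with each $A_i\in\mathbf{F}[Y,Z]$. Then $A_0=Z^p-ZY^{p-1}$, $A_p=A_{p-1}=0$ and $$A_i=\begin{cases}\sum_{k=1}^{i+1}\xi_{ik}Z^kY^{p-i-k} & \text{for } 1\le i\le \frac{p-1}{2},\\ \sum_{k=1}^{p-i}\xi_{ik}Z^kY^{p-i-k} & \text{for } \frac{p+1}{2}\le i\le p-2,\end{cases}$$ where $\xi_{ik}=\dfrac{(-1)^{i}}{2^i(p-k)}\dbinom{p-2k+1}{i-k+1}\dbinom{p-k}{k-1}$, viewed as an element of $\mathbf{F}_p\subseteq\mathbf{F}$.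
   Context: For $n\le p$, $V_n$ is the $n$-dimensional indecomposable representation over $\mathbf{F}$ of the cyclic group $\mathbf{Z}/p=\langle\sigma\rangle$ on which $\sigma$ acts by a single $n\times n$ Jordan block with eigenvalue $1$. The action on the dual $V_n^*$ extends to an action by algebra automorphisms on the symmetric algebra $\mathbf{F}[V_n]=S(V_n^* )$, and $\Delta:=\sigma-1$. Thus here $\sigma(X)=X$, $\sigma(Y)=Y+X$, $\sigma(Z)=Z+Y$, and $\mathbf{F}[V_3]=\mathbf{F}[X,Y,Z]$. *)

(* Defs.v *)
From mathcomp Require Import all_boot all_order all_algebra.
From mathcomp Require Export mpoly.

Set Implicit Arguments.
Unset Strict Implicit.
Unset Printing Implicit Defensive.

Import GRing.Theory.
Local Open Scope ring_scope.

(* V_n is 'cV[F]_n, on which sigma acts by v |-> jordan_block *m v.  The dual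
   V_n^* is 'rV[F]_n, a row u standing for the functional v |-> u *m v.  No
   hypothesis n <= p is needed to write these down; it is what makes sigma have
   order dividing p = char F. *)
Definition jordan_block (F : fieldType) (n : nat) : 'M[F]_n :=
  \matrix_(i < n, j < n) ((j == i :> nat) || (j == i.+1 :> nat))%:R.

(* (sigma u)(v) = u (sigma^-1 v) *)
Definition dual_sigma (F : fieldType) (n : nat) (u : 'rV[F]_n) : 'rV[F]_n :=
  u *m invmx (jordan_block F n).

Definition dual_Delta (F : fieldType) (n : nat) (u : 'rV[F]_n) : 'rV[F]_n :=
  dual_sigma u - u.

(* The inclusion of V_n^* in its symmetric algebra F[V_n] = {mpoly F[n]}, in
   which 'X_i is the i-th coordinate function on V_n. *)
Definition linear_form (F : fieldType) (n : nat) (u : 'rV[F]_n) :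
    {mpoly F[n]} :=
  \sum_(i < n) u 0 i *: 'X_i.

(* The algebra endomorphism of F[V_n] extending dual_sigma. *)
Definition sigma (F : fieldType) (n : nat) (f : {mpoly F[n]}) : {mpoly F[n]} :=
  comp_mpoly [tuple linear_form (dual_sigma (delta_mx 0 i)) | i < n] f.

Definition orbit_norm (F : fieldType) (n p : nat) (f : {mpoly F[n]}) :
    {mpoly F[n]} :=
  \prod_(1 <= i < p.+1) iter i (@sigma F n) f.

(* The subalgebra F[Y, Z] of F[V_n]. *)
Definition in_subalgebra (F : fieldType) (n : nat) (Y Z f : {mpoly F[n]}) :
    Prop :=
  exists g : {mpoly F[2]}, f = comp_mpoly [tuple Y; Z] g.

Definition is_expansion (F : fieldType) (n p : nat) (X Y Z f : {mpoly F[n]})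
    (A : nat -> {mpoly F[n]}) : Prop :=
  (forall i, (i <= p)%N -> in_subalgebra Y Z (A i)) /\
  f = \sum_(0 <= i < p.+1) A i * X ^+ i.

(* The rational number xi_ik has denominator prime to p = char F when
   1 <= k < p and p is odd, so its image in F is computed by casting the
   numerator and the denominator.  In the range of the theorem k <= i + 1 and
   2k <= p + 1, so the subtractions on nat below do not truncate; this is why
   they are written p.+1 - 2 * k and i.+1 - k. *)
Definition xi (F : fieldType) (p i k : nat) : F :=
  (-1) ^+ i / (2 ^+ i * (p - k)%:R)
    * 'C(p.+1 - 2 * k, i.+1 - k)%:R * 'C(p - k, k.-1)%:R.

(* Main.v *)
(* Put [u = X / 2], [s = u - Y] and [q = u Z].  Since [sigma^i Z = Z + i Y + C(i,2) X],
   we have [u * sigma^i Z = (u i)^2 - s (u i) + q = (u i - a) (u i - b)] with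
   [a + b = s] and [a b = q].  The product over [i] in F_p of [a - u i] is
   [a^p - u^(p-1) a], which gives
     [N(Z) = Z^p + Z u^(p-1) - Z (a^(p-1) + b^(p-1))].
   The power sum is the Dickson polynomial
     [sum_j (p-1)/(p-1-j) C(p-1-j, j) (-q)^j s^(p-1-2j)],
   and expanding the powers of [s = X / 2 - Y] yields the coefficients [xi],
   with [k = j + 1].  The term [Z u^(p-1)] cancels the coefficient of [X^(p-1)]. *)
Require Import Defs.
From HB Require Import structures.
From mathcomp Require Import all_boot all_order all_algebra.
From mathcomp Require Import ring zify.
Set Implicit Arguments.
Unset Strict Implicit.

Import GRing.Theory.
Local Open Scope ring_scope.

(** * Multiples of [u] by the prime field as roots of [T^p - u^(p-1) T] *)

Lemma natr_inj_range (R : nzRingType) (p i j : nat) :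
    p \in [pchar R] -> (0 < i <= p)%N -> (0 < j <= p)%N ->
  i%:R = j%:R :> R -> i = j.
Proof.
move=> chR; wlog le_ij : i j / (i <= j)%N.
  by case: (leqP i j) => [/[swap] H|/ltnW /[swap] H] le /[dup] *;
    [apply: H|apply/esym/H].
move=> /andP[i_gt0 _] /andP[_ le_jp] /esym/eqP.
rewrite -subr_eq0 -natrB // -(dvdn_pcharf chR) => p_dvd.
apply/eqP; rewrite eqn_leq le_ij -subn_eq0 /=.
apply: contraLR p_dvd => ji_neq0; rewrite gtnNdvd ?lt0n //; lia.
Qed.

(** Both sides are monic of degree [p] and vanish at the [p] distinct points [u * i], the right-hand
    side by Frobenius. Their difference has degree below [p], so it is zero. *)
Lemma prod_XsubC_multiples (R : idomainType) (p : nat) (u : R) :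
    p \in [pchar R] -> u != 0 ->
  \prod_(1 <= i < p.+1) ('X - (u * i%:R)%:P) = 'X^p - u ^+ p.-1 *: 'X.
Proof.
move=> chR u_neq0; have p_pr := pcharf_prime chR.
have p_gt1 := prime_gt1 p_pr.
pose rs := [seq u * i%:R | i <- index_iota 1 p.+1].
have size_rs : size rs = p by rewrite size_map size_iota subn1.
rewrite -(big_map (fun i => u * i%:R) xpredT (fun c => 'X - c%:P)) -/rs.
apply/eqP; rewrite -subr_eq0; apply/eqP.
apply: (@roots_geq_poly_eq0 _ _ rs).
- apply/allP => c c_rs; rewrite rootE hornerD hornerN.
  move: (c_rs); rewrite -root_prod_XsubC rootE => /eqP ->.
  case/mapP: c_rs => i _ ->; rewrite add0r oppr_eq0.
  rewrite hornerD hornerN hornerZ hornerXn hornerX.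
  rewrite exprMn -[i%:R ^+ p](pFrobenius_autE chR) pFrobenius_aut_nat.
  by rewrite mulrA -exprSr prednK ?subrr // ltnW.
- rewrite map_inj_in_uniq ?iota_uniq // => i j.
  rewrite !mem_index_iota !ltnS => i_range j_range /(mulfI u_neq0).
  exact: (natr_inj_range chR).
rewrite size_rs; apply/leq_sizeP => j le_pj; rewrite coefB.
have [->|/negbTE neq_jp] := eqVneq j p.
  have /monicP := monic_prod_XsubC rs xpredT id.
  rewrite /lead_coef size_prod_XsubC size_rs /= => ->.
  rewrite coefB coefZ coefX coefXn eqxx (gtn_eqF p_gt1).
  by rewrite mulr0 subr0 subrr.
have lt_pj : (p < j)%N by rewrite ltn_neqAle eq_sym neq_jp.
rewrite [X in X - _]nth_default; last by rewrite size_prod_XsubC size_rs.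
rewrite coefB coefZ coefX coefXn neq_jp (gtn_eqF (ltn_trans p_gt1 lt_pj)).
by rewrite mulr0 !subr0.
Qed.

(** * Products over the roots of a quadratic *)

(** Its characteristic polynomial is [T^2 - s T + q]; matrices over [R] avoid adjoining the
    roots. *)
Definition companion2 (R : pzRingType) (s q : R) : 'M[R]_2 :=
  \matrix_(i, j) if (i == 0) then (if j == 0 then 0 else - q)
                 else (if j == 0 then 1 else s).

Lemma det2E (R : comPzRingType) (A : 'M[R]_2) :
  \det A = A 0 0 * A 1 1 - A 0 1 * A 1 0.
Proof.
rewrite (expand_det_row _ 0) !big_ord_recl big_ord0 addr0.
rewrite /cofactor !det_mx11 !mxE /= expr0 expr1 mul1r mulN1r mulrN.
by congr (_ * A _ _ - A _ _ * A _ _); apply/val_inj.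
Qed.

Lemma tr2E (R : pzRingType) (A : 'M[R]_2) : \tr A = A 0 0 + A 1 1.
Proof.
rewrite /mxtrace !big_ord_recl big_ord0 addr0.
by congr (_ + A _ _); apply/val_inj.
Qed.

Lemma det2_subC (R : comPzRingType) (A : 'M[R]_2) (w : R) :
  \det (A - w%:M) = w ^+ 2 - w * \tr A + \det A.
Proof. by rewrite !det2E tr2E !mxE /= !mulr0n !mulr1n; ring. Qed.

Lemma det_companion2 (R : comPzRingType) (s q : R) : \det (companion2 s q) = q.
Proof. by rewrite det2E !mxE /=; ring. Qed.

Lemma tr_companion2 (R : comPzRingType) (s q : R) : \tr (companion2 s q) = s.
Proof. by rewrite tr2E !mxE /=; ring. Qed.

(** Cayley-Hamilton, the source of the recurrence for traces of powers. *)
Lemma companion2_sqr (R : comNzRingType) (s q : R) :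
  companion2 s q ^+ 2 = s *: companion2 s q - q%:M.
Proof.
apply/matrixP => -[[|[|//]] ?] [[|[|//]] ?];
  rewrite expr2 !mxE !big_ord_recl big_ord0 !mxE /= ?mulr0n ?mulr1n; ring.
Qed.

(* The companion matrix stands for the pair of roots [a, b]: determinants are
   products over both roots, traces are sums. *)
Lemma prod_quadratic (R : idomainType) (p : nat) (u s q : R) :
    p \in [pchar R] -> u != 0 ->
  \prod_(1 <= i < p.+1) ((u * i%:R) ^+ 2 - (u * i%:R) * s + q) =
  q * (u ^+ p.-1 ^+ 2 - u ^+ p.-1 * \tr (companion2 s q ^+ p.-1) + q ^+ p.-1).
Proof.
move=> chR u_neq0; set C := companion2 s q.
have detX n : \det (C ^+ n) = q ^+ n.
  elim: n => [|n IHn]; first by rewrite !expr0 det1.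
  by rewrite !exprS det_mulmx IHn det_companion2.
transitivity (\det (\prod_(1 <= i < p.+1) (C - (u * i%:R)%:M))).
  rewrite (big_morph _ (@det_mulmx _ _) (@det1 _ _)); apply: eq_bigr => i _.
  by rewrite det2_subC det_companion2 tr_companion2.
(* The identity [prod_XsubC_multiples] evaluated at the matrix [C]. *)
have -> : \prod_(1 <= i < p.+1) (C - (u * i%:R)%:M) = C * (C ^+ p.-1 - (u ^+ p.-1)%:M).
  rewrite mulrBr -exprS prednK ?prime_gt0 ?(pcharf_prime chR) //.
  rewrite -[X in _ * X]scalemx1 -scalerAr mulr1.
  rewrite -[X in X ^+ p - _](horner_mx_X C) -[X in _ - _ *: X](horner_mx_X C).
  rewrite -rmorphXn -linearZ -rmorphB -prod_XsubC_multiples // rmorph_prod.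
  by apply: eq_bigr => i _; rewrite rmorphB /= horner_mx_X horner_mx_C.
by rewrite det_mulmx det_companion2 det2_subC detX.
Qed.

(** * Power sums of the two roots as Dickson polynomials *)

(* Chebyshev-like polynomials of the second kind; the binomial vanishes as
   soon as [n - j.*2] truncates. *)
Definition dicksonU (R : comPzRingType) (s q : R) (n : nat) : R :=
  \sum_(0 <= j < n.+1) 'C(n - j, j)%:R * (- q) ^+ j * s ^+ (n - j.*2).

(** Pascal's rule for ['C(n.+1 - j, j.+1)], after shifting the index by one. *)
Lemma dicksonU_rec (R : comPzRingType) (s q : R) (n : nat) :
  dicksonU s q n.+2 = s * dicksonU s q n.+1 - q * dicksonU s q n.
Proof.
rewrite /dicksonU big_nat_recl // big_nat_recr // subnn bin0n !mul0r /= addr0.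
rewrite [X in _ = s * X - _]big_nat_recl // !bin0 expr0 !mul1r.
rewrite mulrDr -exprS -addrA; congr (_ + _).
rewrite !mulr_sumr -sumrN -big_split /=; apply: eq_big_nat => j /andP[_ le_jn].
rewrite doubleS !subSS subSn // binS natrD mulrDl mulrDl; congr (_ + _).
  case: (leqP n j.*2) => [le_nj|lt_jn].
    by rewrite bin_small ?ltnS ?leq_subLR ?addnn ?mul0r ?mulr0.
  rewrite mulrCA -exprS; congr (_ * _ ^+ _); lia.
by rewrite exprS; ring.
Qed.

(** Both sides satisfy [w_(n+2) = s w_(n+1) - q w_n] with the same two initial values; the induction
    therefore carries two consecutive cases. *)
Lemma tr_companion2X (R : comNzRingType) (s q : R) (n : nat) :
  \tr (companion2 s q ^+ n.+1) = 2 * dicksonU s q n.+1 - s * dicksonU s q n.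
Proof.
suff: \tr (companion2 s q ^+ n.+1) = 2 * dicksonU s q n.+1 - s * dicksonU s q n
   /\ \tr (companion2 s q ^+ n.+2) = 2 * dicksonU s q n.+2 - s * dicksonU s q n.+1.
  by case.
have stepC m : \tr (companion2 s q ^+ m.+2) =
    s * \tr (companion2 s q ^+ m.+1) - q * \tr (companion2 s q ^+ m).
  rewrite -(addn2 m) exprD companion2_sqr mulrBr -scalerAr -exprSr linearB linearZ /=.
  by rewrite -[q%:M]scalemx1 -scalerAr mulr1 linearZ.
have U0 : dicksonU s q 0 = 1.
  by rewrite /dicksonU big_nat1 bin0 !expr0 !mulr1.
have U1 : dicksonU s q 1 = s.
  by rewrite /dicksonU big_nat_recl // big_nat1 bin0n bin0 !mul0r addr0 expr0 !mul1r.
elim: n => [|n [IHn IHn1]]; last split=> //.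
  rewrite stepC expr1 tr_companion2 expr0 mxtrace1 dicksonU_rec U0 U1.
  by split; ring.
by rewrite stepC IHn IHn1 !dicksonU_rec; ring.
Qed.

Lemma tr_companion2X_sum (R : comNzRingType) (s q : R) (n : nat) :
  \tr (companion2 s q ^+ n.+1) =
  \sum_(0 <= j < n.+1) (2 * 'C(n.+1 - j, j)%:R - 'C(n - j, j)%:R) *
                       ((- q) ^+ j * s ^+ (n.+1 - j.*2)).
Proof.
rewrite tr_companion2X /dicksonU big_nat_recr // subnn bin0n !mul0r /= addr0.
rewrite !mulr_sumr -sumrN -big_split /=; apply: eq_big_nat => j /andP[_ le_jn].
rewrite mulrBl -!mulrA; congr (_ - _).
case: (leqP n.+1 j.*2) => [le_nj|lt_jn].
  by rewrite bin_small ?mul0r ?mulr0 //; lia.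
rewrite mulrCA [s * _]mulrCA -exprS; congr (_ * (_ * _ ^+ _)); lia.
Qed.

(** * Closed form of the norm *)

(** Multiplying by [u^p], cancelled at the end, makes each factor a quadratic in [u i], since
    [2 C(i,2) = i (i - 1)]. *)
Lemma prod_norm_form (R : idomainType) (p : nat) (u Y Z : R) :
    p \in [pchar R] -> u != 0 ->
  \prod_(1 <= i < p.+1) (Z + Y *+ i + (u *+ 2) *+ 'C(i, 2)) =
  Z ^+ p + Z * u ^+ p.-1 - Z * \tr (companion2 (u - Y) (u * Z) ^+ p.-1).
Proof.
move=> chR u_neq0; have p_gt0 := prime_gt0 (pcharf_prime chR).
apply: (mulfI (expf_neq0 p u_neq0)).
have -> : u ^+ p * \prod_(1 <= i < p.+1) (Z + Y *+ i + (u *+ 2) *+ 'C(i, 2)) =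
    \prod_(1 <= i < p.+1) ((u * i%:R) ^+ 2 - (u * i%:R) * (u - Y) + u * Z).
  rewrite -[X in u ^+ X]/(p.+1.-1) -subn1 -prodr_const_nat -big_split /=.
  apply: eq_big_nat => i /andP[i_gt0 _].
  rewrite -mulrnA -mul_bin_diag bin1 -[u *+ _]mulr_natr -[Y *+ _]mulr_natr.
  by case: i i_gt0 => // i _; rewrite natrM -natr1; ring.
rewrite prod_quadratic // exprMn.
have pS (a : R) : a ^+ p = a * a ^+ p.-1 by rewrite -exprS prednK.
by rewrite !pS; ring.
Qed.

(** With [m = n + 1], this rests on [(m-j) C(m-1-j, j) = (m-2j) C(m-j, j)]. It is the classical
    coefficient [m/(m-j) C(m-j, j)] with its denominator cleared. *)
Lemma dickson_coef (R : comPzRingType) (n j : nat) : (j <= n)%N ->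
  (n.+1 - j)%:R * (2 * 'C(n.+1 - j, j)%:R - 'C(n - j, j)%:R) =
  n.+1%:R * 'C(n.+1 - j, j)%:R :> R.
Proof.
move=> le_jn.
rewrite mulrBr -[X in _ - X]natrM (_ : n - j = (n.+1 - j).-1)%N; last lia.
rewrite mul_bin_down natrM mulrA -mulrBl.
have [lt_nj|le_jn2] := ltnP n.+1 j.*2.
  by rewrite bin_small ?mulr0 //; lia.
congr (_ * _); rewrite -[2]/(2%:R) -natrM -natrB; last lia.
congr (_%:R); lia.
Qed.

(** The case [n + 1 = p - 1], [j = k - 1] of [dickson_coef]: the numerator [p - 1] becomes [-1]. *)
Lemma dickson_coef_pchar (F : fieldType) (p k : nat) :
    p \in [pchar F] -> (1 <= k < p)%N ->
  2 * 'C(p - k, k.-1)%:R - 'C(p.-1 - k, k.-1)%:R =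
  - ((p - k)%:R^-1 * 'C(p - k, k.-1)%:R) :> F.
Proof.
move=> chF /andP[k_gt0 lt_kp].
have pk_neq0 : (p - k)%:R != 0 :> F.
  by rewrite -(dvdn_pcharf chF) gtnNdvd //; lia.
apply: (mulfI pk_neq0); rewrite mulrN mulVKf //.
have := @dickson_coef F (p.-2) (k.-1).
rewrite (_ : p.-2.+1 - k.-1 = p - k)%N; last lia.
rewrite (_ : p.-2 - k.-1 = p.-1 - k)%N; last lia.
move=> ->; last lia.
rewrite (_ : p.-2.+1 = p.-1); last lia.
by rewrite -subn1 natrB ?(pcharf0 chF) ?sub0r ?mulN1r //; lia.
Qed.

(** * Coefficients of the powers of [X] *)

(* The last two summands contribute the [Z^p] and [Z (X / 2)^(p-1)] of the
   closed formula for N(Z). *)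
Definition norm_coef (F : fieldType) (R : comAlgType F) (p : nat) (Y Z : R)
    (i : nat) : R :=
  \sum_(1 <= k < p | (k <= i.+1)%N) xi F p i k *: (Z ^+ k * Y ^+ (p - i - k))
  + (i == 0)%:R * Z ^+ p + ((2^-1 : F) ^+ i * (i == p.-1)%:R) *: Z.

(** Binomial expansion of [(u - Y)^(p+1-2k)]: the term in [u^l] contributes to [X^i] with
    [i = l + k - 1]. The filter [k <= i.+1] matters, because [i.+1 - k] truncates outside it and
    [xi] need not vanish there. *)
Lemma xi_expansion (F : fieldType) (R : comAlgType F) (p k : nat) (X Y Z : R) :
    odd p -> (1 <= k < p)%N ->
  let u := 2^-1 *: X in
  ((p - k)%:R^-1 * 'C(p - k, k.-1)%:R : F) *:
     (Z * (- (u * Z)) ^+ k.-1 * (u - Y) ^+ (p.-1 - k.-1.*2)) =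
  \sum_(0 <= i < p.+1 | (k <= i.+1)%N)
     xi F p i k *: (Z ^+ k * Y ^+ (p - i - k)) * X ^+ i.
Proof.
move=> odd_p /andP[k_gt0 lt_kp] u.
have [lt_p2k|le_2kp] := ltnP p.+1 k.*2.
  rewrite bin_small ?mulr0 ?scale0r; last lia.
  rewrite big1 // => i _; rewrite /xi [X in _ * X%:R]bin_small; last lia.
  by rewrite mulr0 scale0r mul0r.
rewrite (eq_bigl (fun i => true && (k.-1 <= i)%N)); last by move=> i; lia.
rewrite -big_nat_widenl // -[k.-1 in RHS]add0n big_addn.
rewrite (_ : p.-1 - k.-1.*2 = p.+1 - k.*2)%N; last lia.
set m := (p.+1 - k.*2)%N.
rewrite addrC exprDn -(big_mkord xpredT
  (fun l => (- Y) ^+ (m - l) * u ^+ l *+ 'C(m, l))).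
(* The range of [i] exceeds that of the binomial sum; the surplus terms have ['C(m, l) = 0]. *)
rewrite (big_nat_widen 0 m.+1 (p.+1 - k.-1)); last by rewrite /m; lia.
rewrite mulr_sumr scaler_sumr [LHS]big_mkcond /=; apply: eq_big_nat => l /andP[_ lt_l].
rewrite /xi (_ : p.+1 - 2 * k = m)%N; last by rewrite /m; lia.
rewrite (_ : (l + k.-1).+1 - k = l)%N; last lia.
case: (ltnP l m.+1) => [le_lm|lt_ml]; last first.
  by rewrite (bin_small lt_ml) mulr0 mul0r scale0r mul0r.
rewrite (_ : p - (l + k.-1) - k = m - l)%N; last by rewrite /m; lia.
(* As [p] is odd, [m] is even, and the signs combine to [(-1)^i]. *)
have sign_ml : (-1) ^+ (m - l) = (-1) ^+ l :> F.
  by rewrite -signr_odd -[RHS]signr_odd oddB // /m oddB // /= odd_p odd_double.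
rewrite -[- Y]scaleN1r -[- (u * Z)]scaleN1r /u -[_ *+ 'C(m, l)]scaler_nat.
rewrite -[in Z ^+ k](prednK k_gt0) exprS !exprD.
rewrite !(exprZn, exprMn) -?(scalerAl, scalerAr) !scalerA.
rewrite sign_ml; congr (_ *: _); first by rewrite !exprVn !invfM; ring.
by ring.
Qed.

(** The trace is expanded by [xi_expansion], and exchanging the sums collects the powers of [X]. *)
Lemma norm_expansion (F : fieldType) (R : comAlgType F) (p : nat) (X Y Z : R) :
    p \in [pchar F] -> (2 < p)%N ->
  let u := 2^-1 *: X in
  Z ^+ p + Z * u ^+ p.-1 - Z * \tr (companion2 (u - Y) (u * Z) ^+ p.-1) =
  \sum_(0 <= i < p.+1) norm_coef p Y Z i * X ^+ i.
Proof.
move=> chF p_gt2 u; have p_pr := pcharf_prime chF.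
have odd_p : odd p by case: (even_prime p_pr) p_gt2 => [->|].
have -> : Z * \tr (companion2 (u - Y) (u * Z) ^+ p.-1) =
    - \sum_(1 <= k < p) \sum_(0 <= i < p.+1 | (k <= i.+1)%N)
      xi F p i k *: (Z ^+ k * Y ^+ (p - i - k)) * X ^+ i.
  rewrite -[p.-1](prednK (n := p.-1)); last lia.
  rewrite tr_companion2X_sum mulr_sumr -sumrN big_add1.
  rewrite prednK; last lia.
  apply: eq_big_nat => j /andP[_ lt_j]; rewrite -xi_expansion //; last lia.
  rewrite -scaleNr -dickson_coef_pchar //; last lia.
  rewrite /= (_ : p.-1 - j = p - j.+1)%N; last lia.
  rewrite (_ : p.-2 - j = p.-1 - j.+1)%N; last lia.
  rewrite scalerBl -!natrM !scaler_nat mulrBl !mulr_natl mulrBr !mulrnAr.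
  by rewrite !mulrA.
rewrite opprK (exchange_big_dep_nat xpredT) //=.
under [RHS]eq_bigr do rewrite /norm_coef mulrDl mulrDl.
rewrite !big_split /= [LHS]addrC [LHS]addrA; congr (_ + _ + _).
- by apply: eq_bigr => i _; rewrite mulr_suml.
- rewrite big_nat_recl // expr0 eqxx mul1r mulr1 big1 ?addr0 // => i _.
  by rewrite !mul0r.
have lt_p1 : (p.-1 < p.+1)%N by lia.
rewrite (bigD1_seq p.-1) ?mem_index_iota ?iota_uniq //= eqxx mulr1.
rewrite big1 ?addr0 => [|i /negbTE ->]; last by rewrite mulr0 scale0r mul0r.
by rewrite exprZn -scalerAl -scalerAr.
Qed.

(** Either [k - 1 > p - k] or [i + 1 - k > p + 1 - 2k], so a binomial vanishes. This removes the
    terms where the exponent of [Y] truncates. *)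
Lemma xi_eq0 (F : fieldType) (p i k : nat) :
  (k < p)%N -> (p < i + k)%N -> (k <= i.+1)%N -> xi F p i k = 0.
Proof.
move=> lt_kp lt_p le_k; rewrite /xi; have [lt_2k|le_2k] := ltnP p.+1 k.*2.
  by rewrite [X in _ * X%:R]bin_small ?mulr0 //; lia.
by rewrite bin_small ?mulr0 ?mul0r //; lia.
Qed.

Lemma norm_coef0 (F : fieldType) (R : comAlgType F) (p : nat) (Y Z : R) :
    p \in [pchar F] -> (2 < p)%N ->
  norm_coef p Y Z 0 = Z ^+ p - Z * Y ^+ (p - 1).
Proof.
move=> chF p_gt2; rewrite /norm_coef eqxx mul1r (ltn_eqF (_ : 0 < p.-1)%N); last lia.
rewrite mulr0 scale0r addr0 addrC; congr (_ + _).
(* For [i = 0] only [k = 1] remains, with [xi] equal to [1/(p-1) = -1]. *)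
rewrite -(big_nat_widen 1 2 p xpredT) ?big_nat1; last lia.
rewrite /xi muln1 subn0 !expr0 expr1 !bin0 mulr1 mul1r natrB; last lia.
by rewrite (pcharf0 chF) sub0r !mul1r invrN1 mulr1 scaleN1r.
Qed.

Lemma norm_coef_gt0 (F : fieldType) (R : comAlgType F) (p i : nat) (Y Z : R) :
    (0 < i)%N -> i != p.-1 ->
  norm_coef p Y Z i =
  \sum_(1 <= k < p | (k <= i.+1)%N) xi F p i k *: (Z ^+ k * Y ^+ (p - i - k)).
Proof.
move=> i_gt0 /negbTE neq_i; rewrite /norm_coef (gtn_eqF i_gt0) neq_i.
by rewrite mul0r mulr0 scale0r !addr0.
Qed.

Lemma norm_coef_p (F : fieldType) (R : comAlgType F) (p : nat) (Y Z : R) :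
  (0 < p)%N -> norm_coef p Y Z p = 0.
Proof.
move=> p_gt0; rewrite norm_coef_gt0 //; last lia.
rewrite big_nat_cond big1 // => k /andP[/andP[k_gt0 lt_kp] le_k].
by rewrite xi_eq0 ?scale0r //; lia.
Qed.

(** Only [k = 1] survives, with coefficient [-2^(1-p)] as [p - 1] is even; the summand from
    [Z u^(p-1)] cancels it. *)
Lemma norm_coef_pred (F : fieldType) (R : comAlgType F) (p : nat) (Y Z : R) :
    p \in [pchar F] -> (2 < p)%N ->
  norm_coef p Y Z p.-1 = 0.
Proof.
move=> chF p_gt2; have p_pr := pcharf_prime chF.
have odd_p : odd p by case: (even_prime p_pr) p_gt2 => [->|].
rewrite /norm_coef eqxx (gtn_eqF (_ : 0 < p.-1)%N); last lia.
rewrite mul0r addr0 mulr1 big_ltn_cond //; last lia.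
rewrite [X in _ + X + _]big_nat_cond big1 ?addr0 => [|k]; last first.
  by move=> /andP[/andP[k_gt1 lt_kp] le_k]; rewrite xi_eq0 ?scale0r //; lia.
rewrite (_ : p - p.-1 - 1 = 0)%N ?expr0 ?expr1 ?mulr1; last lia.
rewrite -scalerDl /xi muln1 !subSS subn0.
rewrite (_ : 'C(p - 1, p.-1) = 1)%N; last by rewrite subn1 binn.
rewrite bin0 !mulr1 natrB; last lia.
rewrite (pcharf0 chF) sub0r -signr_odd (_ : odd p.-1 = false); last lia.
by rewrite mulrN1 invrN mul1r exprVn addNr scale0r.
Qed.

Lemma norm_coef_low (F : fieldType) (R : comAlgType F) (p i : nat) (Y Z : R) :
    odd p -> (1 <= i <= (p - 1) %/ 2)%N -> (2 < p)%N ->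
  norm_coef p Y Z i =
  \sum_(1 <= k < i.+2) xi F p i k *: (Z ^+ k * Y ^+ (p - i - k)).
Proof.
move=> odd_p i_range p_gt2; rewrite norm_coef_gt0; [|lia|lia].
by rewrite (big_nat_widen 1 i.+2 p) //; lia.
Qed.

Lemma norm_coef_high (F : fieldType) (R : comAlgType F) (p i : nat) (Y Z : R) :
    odd p -> ((p + 1) %/ 2 <= i <= p - 2)%N -> (2 < p)%N ->
  norm_coef p Y Z i =
  \sum_(1 <= k < (p - i).+1) xi F p i k *: (Z ^+ k * Y ^+ (p - i - k)).
Proof.
move=> odd_p i_range p_gt2; rewrite norm_coef_gt0; [|lia|lia].
rewrite (big_nat_widen 1 (p - i).+1 p); last lia.
rewrite [LHS]big_mkcond [RHS]big_mkcond; apply: eq_big_nat => k k_range.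
(* Since [p - i <= i], the filter also admits [p - i < k <= i + 1], where [xi] vanishes. *)
rewrite /=; case: ifP => le_k; case: ifP => le_k' //; last lia.
by rewrite xi_eq0 ?scale0r //; lia.
Qed.

(** Shows that the coefficients lie in [F[Y, Z]], as images of the same formula in two variables. *)
Lemma rmorph_norm_coef (F : fieldType) (R S : comAlgType F)
    (f : {lrmorphism R -> S}) (p i : nat) (Y Z : R) :
  f (norm_coef p Y Z i) = norm_coef p (f Y) (f Z) i.
Proof.
rewrite /norm_coef !rmorphD /= linearZ rmorphM /= rmorphXn rmorph_nat rmorph_sum.
congr (_ + _ + _); apply: eq_bigr => k _.
by rewrite /= linearZ_LR rmorphM /= !rmorphXn.
Qed.

(** * Linear forms and the action of [sigma] *)

(** A morphism with prescribed values on a free family: ['X_j] is sent to the combination of [v]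
    given by the [b]-coordinates of [delta_mx 0 j]. *)
Lemma mmap_linear_form (F : fieldType) (n m : nat) (S : comNzRingType)
    (f : {rmorphism F -> S}) (b : m.-tuple 'rV[F]_n) (v : 'I_m -> S) (i : 'I_m) :
    free b ->
  mmap f (fun j => \sum_l f (coord b l (delta_mx 0 j)) * v l)
    (linear_form b`_i) = v i.
Proof.
move=> b_free; transitivity (\sum_l f (coord b l b`_i) * v l); last first.
  rewrite (bigD1 i) //= coord_free // eqxx rmorph1 mul1r.
  rewrite big1 ?addr0 // => l /negbTE neq_li.
  by rewrite coord_free // eq_sym neq_li rmorph0 mul0r.
rewrite /linear_form raddf_sum.
under eq_bigr do rewrite /= mmapZ mmapX mmap1U mulr_sumr.
rewrite exchange_big; apply: eq_bigr => l _ /=.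
rewrite [in RHS](row_sum_delta b`_i) linear_sum rmorph_sum mulr_suml.
by apply: eq_bigr => j _; rewrite linearZ /= rmorphM mulrA.
Qed.

Lemma linear_form_is_linear (F : fieldType) (n : nat) :
  linear (@linear_form F n).
Proof.
move=> a u v; rewrite /linear_form scaler_sumr -big_split.
by apply: eq_bigr => i _; rewrite !mxE scalerDl scalerA.
Qed.

HB.instance Definition _ (F : fieldType) (n : nat) :=
  GRing.isLinear.Build F 'rV[F]_n {mpoly F[n]} _ (@linear_form F n)
    (@linear_form_is_linear F n).

Lemma sigma_linear_form (F : fieldType) (n : nat) (u : 'rV[F]_n) :
  sigma (linear_form u) = linear_form (dual_sigma u).
Proof.
rewrite [in RHS](row_sum_delta u) /dual_sigma mulmx_suml linear_sum.
rewrite /sigma {1}/linear_form linear_sum.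
apply: eq_bigr => i _.
by rewrite linearZ /= comp_mpolyXU -tnth_nth tnth_mktuple -scalemxAl linearZ.
Qed.

(** Binomial expansion of [(1 + Delta)^i], cut off by [Delta^3 z = 0]. *)
Lemma iter_sigma_linear_form (F : fieldType) (n i : nat) (x y z : 'rV[F]_n) :
    dual_Delta z = y -> dual_Delta y = x -> dual_Delta x = 0 ->
  iter i (@sigma F n) (linear_form z) =
  linear_form z + linear_form y *+ i + linear_form x *+ 'C(i, 2).
Proof.
have shift u w : dual_Delta u = w -> dual_sigma u = u + w.
  by move=> <-; rewrite addrC subrK.
move=> /shift zE /shift yE /shift xE; elim: i => [|i IHi].
  by rewrite bin0n !mulr0n !addr0.
rewrite iterS IHi -!raddfMn -!raddfD sigma_linear_form /=; congr linear_form.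
rewrite /dual_sigma !mulmxDl -!scaler_nat -!scalemxAl.
rewrite -!/(dual_sigma _) zE yE xE addr0 !scaler_nat binS bin1.
by rewrite mulrS mulrnDl mulrnDr !addrA [LHS]addrAC.
Qed.

(** * Uniqueness of the expansion in [X] *)

(* [F[V_3]] is a polynomial ring in [X] over [F[Y, Z]], and [Psi] reads off the
   coefficients of its elements. *)
Lemma coefficient_retraction (F : fieldType) (x y z : 'rV[F]_3) :
    free [:: x; y; z] ->
  exists Psi : {rmorphism {mpoly F[3]} -> {poly {mpoly F[2]}}},
    Psi (linear_form x) = 'X /\
    forall g, Psi (g \mPo [tuple linear_form y; linear_form z]) = g%:P.
Proof.
move=> xyz_free; pose b := [tuple x; y; z].
pose c : {rmorphism F -> {poly {mpoly F[2]}}} := polyC \o @mpolyC 2 F.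
pose v : 'I_3 -> {poly {mpoly F[2]}} :=
  fun l => [:: 'X; ('X_0)%:P; ('X_1)%:P]`_l.
pose Psi : {rmorphism {mpoly F[3]} -> {poly {mpoly F[2]}}} :=
  mmap c (fun j => \sum_l c (coord b l (delta_mx 0 j)) * v l).
have Psi_b (l : 'I_3) : Psi (linear_form b`_l) = v l by exact: mmap_linear_form.
have Psi_x : Psi (linear_form x) = 'X := Psi_b (@Ordinal 3 0 isT).
have Psi_y : Psi (linear_form y) = ('X_0)%:P := Psi_b (@Ordinal 3 1 isT).
have Psi_z : Psi (linear_form z) = ('X_1)%:P := Psi_b (@Ordinal 3 2 isT).
exists Psi; split=> // g.
rewrite comp_mpolyEX [in RHS](mpolyE g) raddf_sum [RHS]raddf_sum.
apply: eq_bigr => m _ /=.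
rewrite [LHS]mmapZ -mul_mpolyC polyCM comp_mpolyX; congr (_ * _).
rewrite -/(Psi _) !big_ord_recl big_ord0 mulr1 mpolyXE_id.
rewrite !big_ord_recl big_ord0 mulr1 polyCM rmorphM !rmorphXn /= Psi_y Psi_z.
by congr (('X_ _)%:P ^+ _ * ('X_ _)%:P ^+ _); apply/val_inj.
Qed.

(** The [i]-th coefficient of [Psi f] determines the [i]-th term, so any expansion is recovered from
    [f] alone. *)
Lemma expansion_unique (F : fieldType) (x y z : 'rV[F]_3) (p : nat)
    (f : {mpoly F[3]}) (A B : nat -> {mpoly F[3]}) (i : nat) :
    free [:: x; y; z] ->
    is_expansion p (linear_form x) (linear_form y) (linear_form z) f A ->
    is_expansion p (linear_form x) (linear_form y) (linear_form z) f B ->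
  (i <= p)%N -> A i = B i.
Proof.
move=> /coefficient_retraction[Psi [Psi_x Psi_yz]].
have coefPsi C :
    is_expansion p (linear_form x) (linear_form y) (linear_form z) f C ->
    (i <= p)%N -> C i = (Psi f)`_i \mPo [tuple linear_form y; linear_form z].
  move=> [C_sub ->] le_ip; rewrite rmorph_sum coef_sum.
  rewrite (bigD1_seq i) ?mem_index_iota ?iota_uniq ?ltnS //=.
  rewrite big1_seq ?addr0 => [|j]; last first.
    rewrite mem_index_iota ltnS /= => /andP[/negbTE neq_ji le_jp].
    have [g ->] := C_sub j le_jp.
    by rewrite rmorphM rmorphXn /= Psi_x Psi_yz coefCM coefXn eq_sym neq_ji mulr0.
  have [g ->] := C_sub i le_ip.
  by rewrite rmorphM rmorphXn /= Psi_x Psi_yz coefCM coefXn (eqxx i) mulr1.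
by move=> /coefPsi A_i /coefPsi B_i le_ip; rewrite A_i ?B_i.
Qed.

(** * Expansion of the norm of [Z] *)

Theorem theorem2p1 (p : nat) (F : fieldType) (x y z : 'rV[F]_3)
    (p_prime : prime p) (p_ge3 : (3 <= p)%N) (charF : p \in [pchar F])
    (xyz_basis : basis_of fullv [:: x; y; z])
    (Delta_z : dual_Delta z = y) (Delta_y : dual_Delta y = x)
    (Delta_x : dual_Delta x = 0) :
  let X := linear_form x in
  let Y := linear_form y in
  let Z := linear_form z in
  let N := orbit_norm p Z in
  (exists A : nat -> {mpoly F[3]}, is_expansion p X Y Z N A) /\
  forall A : nat -> {mpoly F[3]}, is_expansion p X Y Z N A ->
    [/\ A 0%N = Z ^+ p - Z * Y ^+ (p - 1),
        A p = 0,
        A (p - 1)%N = 0,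
        forall i : nat, (1 <= i <= (p - 1) %/ 2)%N ->
          A i = \sum_(1 <= k < i.+2) xi F p i k *: (Z ^+ k * Y ^+ (p - i - k))
      & forall i : nat, ((p + 1) %/ 2 <= i <= p - 2)%N ->
          A i = \sum_(1 <= k < (p - i).+1)
                  xi F p i k *: (Z ^+ k * Y ^+ (p - i - k))].
Proof.
move=> X Y Z N.
have odd_p : odd p by case: (even_prime p_prime) p_ge3 => [->|].
have xyz_free := basis_free xyz_basis.
have charM : p \in [pchar {mpoly F[3]}] by rewrite pchar_lalg.
have two_neq0 : 2 != 0 :> F by rewrite -(dvdn_pcharf charF) gtnNdvd.
(* Needed to cancel powers of [u = X / 2]; [Psi] sends [X] to a variable. *)
have X_neq0 : X != 0.
  have [Psi [Psi_x _]] := coefficient_retraction xyz_free.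
  apply/eqP => X_eq0; move/eqP: Psi_x.
  by rewrite -/X X_eq0 rmorph0 eq_sym polyX_eq0.
have N_expansion : is_expansion p X Y Z N (norm_coef p Y Z).
  split=> [i _|].
    (* The witness is the same formula in the variables of [{mpoly F[2]}]. *)
    exists (norm_coef p 'X_0 'X_1 i : {mpoly F[2]}).
    by rewrite rmorph_norm_coef /= !comp_mpolyXU.
  rewrite -norm_expansion // -prod_norm_form ?scaler_eq0 ?negb_or ?invr_eq0 ?two_neq0 //.
  apply: eq_big_nat => i _; rewrite (iter_sigma_linear_form i Delta_z Delta_y Delta_x).
  by rewrite -[_ *+ 2]scaler_nat scalerA mulfV // scale1r.
split=> [|A A_exp]; first by exists (norm_coef p Y Z).
(* By uniqueness every claim becomes one about [norm_coef]. *)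
have A_i i : (i <= p)%N -> A i = norm_coef p Y Z i.
  exact: expansion_unique A_exp N_expansion.
split=> [||| i i_range | i i_range]; rewrite A_i ?leq_subr //.
- exact: norm_coef0.
- by rewrite norm_coef_p // prime_gt0.
- by rewrite subn1 norm_coef_pred.
- exact: norm_coef_low.
- by lia.
- exact: norm_coef_high.
by lia.
Qed.
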